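(* Let $p\geq 1$ be an integer and let $\mu=(\mu^{(0)},\mu^{(1)},\dots,\mu^{(p-1)})$ be a fixed $p$-tuple of partitions, with $|\mu|=\sum_{i=0}^{p-1}|\mu^{(i)}|$. For every $k\in\mathbb{N}$ let $c(k)=(c_0(k),c_1(k),\dots,c_{p-1}(k))\in\mathbb{Z}^p$ be a characteristic vector (i.e. $\sum_{i=0}^{p-1}c_i(k)=0$), and suppose that for each $i\in\{0,1,\dots,p-1\}$ there is $a_i\in\mathbb{R}$ with $$c_i(k)=a_i k+o(k)\qquad (k\to+\infty).$$ For every $k\in\mathbb{N}$ let $\lambda(k)$ be the unique partition with $p$-quotient $\mu$ and characteristic vector $c(k)$, and let $R_{\lambda(k)}$ be the monic polynomial of degree $|\mu|$ determined by $q_{\lambda(k)}(x)=x^{|\bar\lambda(k)|}R_{\lambda(k)}(x^p)$, where $\bar\lambda(k)$ is the $p$-core of $\lambda(k)$ and $q_{\lambda(k)}$ is the Wronskian polynomial labeled by $\lambda(k)$. Then $$\lim_{k\to+\infty}\frac{R_{\lambda(k)}\big((pk)^{p-1}x\big)}{(pk)^{(p-1)|\mu|}}=\prod_{i=0}^{p-1}(x-\alpha_i)^{|\mu^{(i)}|}$$ uniformly for $x$ in compact subsets of the complex plane, where $$\alpha_i=\prod_{\substack{j=0\\ j\neq i}}^{p-1}(a_i-a_j),\qquad i=0,1,\dots,p-1.$$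
   Context: A partition $\lambda=(\lambda_1\geq\lambda_2\geq\dots\geq\lambda_r>0)$ has length $r$ and size $|\lambda|=\sum_i\lambda_i$; the empty partition $\emptyset$ has size $0$. Characteristic vector, $p$-quotient, $p$-core. To a partition $\lambda$ associate its charge-zero Maya diagram $\widehat M_\lambda=\{\lambda_i-i\mid i\geq 1\}\subset\mathbb{Z}$, where $\lambda_i=0$ for $i>r$ (it has as many elements $\geq 0$ as there are missing integers $<0$). For $S\subset \mathbb{Z}$ and $t\in\mathbb{Z}$, $S+t=\{s+t\mid s\in S\}$. Fix $p\geq1$. For $i=0,\dots,p-1$ put $M^{(i)}=\{m\in\mathbb{Z}\mid pm+i\in\widehat M_\lambda\}$. There are a unique integer $c_i$ and a unique partition $\mu^{(i)}$ with $M^{(i)}=\widehat M_{\mu^{(i)}}+c_i$. The vector $(c_0,\dots,c_{p-1})$ is the characteristic vector of $\lambda$ (it satisfies $\sum_i c_i=0$) and $\mu=(\mu^{(0)},\dots,\mu^{(p-1)})$ is the $p$-quotient of $\lambda$. The map from $\lambda$ to (characteristic vector, $p$-quotient) is a bijection from partitions onto pairs consisting of an integer vector in $\mathbb{Z}^p$ with sum zero and a $p$-tuple of partitions. The $p$-core $\bar\lambda$ of $\lambda$ is the partition with the same characteristic vector as $\lambda$ and with $p$-quotient $(\emptyset,\dots,\emptyset)$. (Equivalently, $\bar\lambda$ is obtained from $\lambda$ by removing border strips of size $p$ as long as possible.) Wronskian polynomials. With the same $p$, define polynomials $q_n$ by $\sum_{n\geq0}q_n(x)\frac{t^n}{n!}=\exp\left(tx-\frac{t^p}{p}\right)$.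 For a partition $\lambda=(\lambda_1,\dots,\lambda_r)$ put $n_i=\lambda_i+r-i$ for $1\leq i\leq r$ and $$q_\lambda=\frac{\det\left(\frac{d^{i-1}}{dx^{i-1}}q_{n_j}\right)_{1\leq i,j\leq r}}{\prod_{1\leq i<j\leq r}(n_j-n_i)},$$ with $q_\emptyset=1$. It is known that $q_\lambda(x)=x^{|\bar\lambda|}R_\lambda(x^p)$ for a monic polynomial $R_\lambda$ of degree $|\mu|$ with non-zero constant term. An empty product equals $1$. *)

(* Defs.v *)
From HB Require Import structures.
From mathcomp Require Import all_boot all_order all_algebra.
From mathcomp Require Import complex.
From mathcomp Require Import all_classical all_reals all_analysis.

Set Implicit Arguments.
Unset Strict Implicit.
Unset Printing Implicit Defensive.

Import Order.TTheory GRing.Theory Num.Theory.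
Import numFieldNormedType.Exports.

Local Open Scope classical_set_scope.
Local Open Scope ring_scope.

Definition is_intpart (s : seq nat) : bool := sorted geq s && (0%N \notin s).

Record intpart := IntPart { parts :> seq nat ; _ : is_intpart parts }.

HB.instance Definition _ := [isSub for parts].
HB.instance Definition _ := [Equality of intpart by <:].

Definition empty_part : intpart := @IntPart [::] isT.

Definition psize (l : intpart) : nat := sumn l.

Definition plength (l : intpart) : nat := size l.

(* The k-th part counted from 0, i.e. lambda_(k+1); it is 0 past the end. *)
Definition part (l : intpart) (k : nat) : nat := nth 0%N l k.

(* With 0-based parts, lambda_i - i for i = k + 1. *)
Definition maya (l : intpart) : set int :=
  [set z | exists k : nat, z = (part l k)%:Z - k.+1%:Z].

Definition translate (S : set int) (t : int) : set int := [set s + t | s in S].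

Definition maya_residue (p : nat) (l : intpart) (i : 'I_p) : set int :=
  [set m : int | maya l (p%:Z * m + i%:Z)].

(* [c] is the characteristic vector and [mu] the p-quotient of [l]; for p > 0
   every [l] has exactly one such pair. *)
Definition char_quotient (p : nat) (l : intpart)
    (c : 'I_p -> int) (mu : 'I_p -> intpart) : Prop :=
  forall i : 'I_p, maya_residue l i = translate (maya (mu i)) (c i).

Definition is_core (p : nat) (l lbar : intpart) : Prop :=
  exists (c : 'I_p -> int) (mu : 'I_p -> intpart),
    char_quotient l c mu /\ char_quotient lbar c (fun=> empty_part).

(* Coefficient of t^n in the formal power series exp(f), for a polynomial
   f = f(t) over {poly F} without constant term: f ^+ k has no terms of degree
   < k in t, so the exponential series may be cut after k = n. *)
Definition exp_coef (F : fieldType) (f : {poly {poly F}}) (n : nat) : {poly F} :=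
  (\sum_(k < n.+1) (k`!%:R^-1 : F)%:P *: f ^+ k)`_n.

(* t x - t^p / p; the outer variable is t and the inner one is x. *)
Definition gen_exponent (F : fieldType) (p : nat) : {poly {poly F}} :=
  ('X : {poly F}) *: 'X - (p%:R^-1 : F)%:P *: 'X^p.

Definition qpoly (F : fieldType) (p n : nat) : {poly F} :=
  n`!%:R *: exp_coef (gen_exponent F p) n.

(* n_i = lambda_i + r - i, with 0-based i. *)
Definition beta_num (l : intpart) (i : nat) : nat := (part l i + plength l - i.+1)%N.

Definition wronskian (F : fieldType) (p : nat) (l : intpart) : {poly F} :=
  \det (\matrix_(i < plength l, j < plength l) (qpoly F p (beta_num l j))^`(i)).

Definition vandermonde_diff (F : fieldType) (l : intpart) : F :=
  \prod_(i < plength l) \prod_(j < plength l | (i < j)%N)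
     ((beta_num l j)%:R - (beta_num l i)%:R).

Definition qwronskian (F : fieldType) (p : nat) (l : intpart) : {poly F} :=
  (vandermonde_diff F l)^-1 *: wronskian F p l.

(* R is the monic polynomial of degree d with
   q_lambda (x) = x ^ |lbar| R(x ^ p). *)
Definition is_remainder (F : fieldType) (p : nat) (l lbar : intpart) (d : nat)
    (R : {poly F}) : Prop :=
  [/\ R \is monic, size R = d.+1
    & qwronskian F p l = 'X^(psize lbar) * (R \Po 'X^p)].

Definition mu_size (p : nat) (mu : 'I_p -> intpart) : nat :=
  (\sum_(i < p) psize (mu i))%N.

Definition alpha (K : comPzRingType) (p : nat) (a : 'I_p -> K) (i : 'I_p) : K :=
  \prod_(j < p | j != i) (a i - a j).

(* Main.v *)
(** The normalised Wronskian is a function Q(n) of the set of beta numbers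
    n_1, ..., n_r of lambda.  The Appell relations give
    x q_n' = n q_n + n (n-1) ... (n-p+1) q_(n-p), and inserting this into the
    Leibniz expansion of x d/dx det yields
    (|lambda| - x d/dx) Q(n) = - sum_l w_l Q(n with n_l replaced by n_l - p),
    w_l = n_l (n_l-1) ... (n_l-p+1) prod_(x <> l) (n_l - p - n_x) / (n_l - n_x).
    Hence the coefficients of R_lambda satisfy an explicit scalar recursion.  In
    terms of the p-quotient the beta numbers are p arithmetic progressions with
    finitely many excited elements; over a progression the product in w_l
    telescopes and cancels the falling factorial, so that only excited elements
    contribute.  For an excited element of class i the weight is p times a
    factor depending only on mu^(i), times p - 1 factors asymptotic to
    (a_i - a_j) p k, which produces alpha_i.  The limit coefficients then satisfy
    the recursion (|mu| - x d/dx) P = - sum_i |mu^(i)| alpha_i P / (x - alpha_i)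
    of P = prod_i (x - alpha_i)^|mu^(i)|, because the mu^(i)-factors add up to
    |mu^(i)| over the excited elements of class i. *)

Require Import Defs.
From HB Require Import structures.
From mathcomp Require Import all_boot all_order all_algebra.
From mathcomp Require Import complex.
From mathcomp Require Import all_classical all_reals all_analysis.
From mathcomp Require Import perm ring zify.

Import Order.TTheory GRing.Theory Num.Theory.
Import numFieldNormedType.Exports.

Local Open Scope classical_set_scope.
Local Open Scope complex_scope.
Local Open Scope ring_scope.

Set Implicit Arguments.
Unset Strict Implicit.
Unset Printing Implicit Defensive.

(** * Determinants with falling factorials *)

Definition upd (J : finType) (V : Type) (n : J -> V) (l : J) (v : V) : J -> V :=
  fun x => if x == l then v else n x.

Lemma upd_eq (J : finType) (V : Type) (n : J -> V) l v : upd n l v l = v.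
Proof. by rewrite /upd eqxx. Qed.

Lemma upd_neq (J : finType) (V : Type) (n : J -> V) l v x :
  x != l -> upd n l v x = n x.
Proof. by rewrite /upd => /negbTE->. Qed.

Lemma prod_upd (A : comPzRingType) (J : finType) (V : Type) (g : J -> V -> A)
    (n : J -> V) l v :
  \prod_x g x (upd n l v x) = g l v * \prod_(x | x != l) g x (n x).
Proof.
rewrite (bigD1 l) //= upd_eq; congr (_ * _).
by apply: eq_bigr => x xl; rewrite upd_neq.
Qed.

Lemma sum_upd (J : finType) (n : J -> nat) l v :
  (\sum_x upd n l v x + n l = \sum_x n x + v)%N.
Proof.
rewrite (bigD1 l) //= upd_eq [in RHS](bigD1 l) //=.
rewrite (eq_bigr n) => [|x xl]; first lia.
by rewrite upd_neq.
Qed.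

Section Determinants.
Variables (A : comPzRingType) (r : nat).

(** In the Leibniz term of a permutation [s] the row factors [d l - s l] add up to a number
    independent of [s], since the column indices always sum to ['C(r, 2)]. *)
Lemma det_sum_rows (B C : 'M[A]_r) (D : 'I_r -> 'M[A]_r) (d : 'I_r -> A) :
  (forall l i j, i != l -> D l i j = B i j) ->
  (forall l j, D l l j = (d l - j%:R) * B l j + C l j) ->
  \sum_l \det (D l) =
    (\sum_l d l - 'C(r, 2)%:R) * \det B
    + \sum_l \det (\matrix_(i, j) if i == l then C l j else B i j).
Proof.
move=> Dne Deq; rewrite /determinant exchange_big /= mulr_sumr.
rewrite [X in _ = _ + X]exchange_big -big_split /=; apply: eq_bigr => s _.
rewrite -!mulr_sumr [_ * (_ * _)]mulrCA -mulrDr; congr (_ * _).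
have -> : \sum_l d l - 'C(r, 2)%:R = \sum_l (d l - (s l)%:R).
  rewrite sumrB; congr (_ - _).
  transitivity (\sum_(i < r) (i%:R : A)).
    by rewrite -natr_sum -bin2_sum big_mkord.
  by rewrite (reindex_inj (@perm_inj _ s)).
rewrite mulr_suml -big_split /=; apply: eq_bigr => l _.
rewrite (bigD1 l) //= Deq [in RHS](bigD1 l) //= [X in _ = _ + X](bigD1 l) //=.
rewrite mxE eqxx mulrDl mulrA; congr (_ * _ + _ * _); apply: eq_bigr => i il.
- by rewrite Dne.
- by rewrite mxE (negbTE il) Dne.
Qed.

End Determinants.

(** * Vandermonde products when one node moves *)

Section Vandermonde.
Variable F : fieldType.

Definition ffpoly (i : nat) : {poly F} := \prod_(m < i) ('X - m%:R%:P).

Lemma size_ffpoly i : size (ffpoly i) = i.+1.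
Proof.
by rewrite /ffpoly -big_enum /= size_prod_XsubC size_enum_ord.
Qed.

Lemma ffpoly_monic i : ffpoly i \is monic.
Proof. by apply: monic_prod => m _; apply: monicXsubC. Qed.

Lemma horner_ffpoly i x : (ffpoly i).[x] = \prod_(m < i) (x - m%:R).
Proof. by rewrite horner_prod; apply: eq_bigr => m _; rewrite hornerXsubC. Qed.

Lemma horner_ffpolyS i x : (ffpoly i.+1).[x] = (x - i%:R) * (ffpoly i).[x].
Proof. by rewrite !horner_ffpoly big_ord_recr /= mulrC. Qed.

Lemma horner_ffpolySl i x : (ffpoly i.+1).[x] = x * (ffpoly i).[x - 1].
Proof.
rewrite !horner_ffpoly big_ord_recl /= subr0; congr (_ * _).
by apply: eq_bigr => m _; rewrite /= /bump /= natrD opprD addrA.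
Qed.

Lemma horner_ffpoly_nat i n : (ffpoly i).[n%:R] = (n ^_ i)%:R.
Proof.
elim: i n => [|i IH] n; first by rewrite /ffpoly big_ord0 hornerE.
rewrite horner_ffpolySl; case: n => [|n]; first by rewrite mul0r.
by rewrite -natr1 addrK IH natr1 ffactnS natrM.
Qed.

Definition vdm (r : nat) (x : 'I_r -> F) : F :=
  \prod_(i < r) \prod_(j < r | (i < j)%N) (x j - x i).

(** Each [ffpoly i] is monic of degree [i], so the passage from monomials to falling factorials is
    unitriangular. *)
Lemma det_ffpoly (r : nat) (x : 'I_r -> F) :
  \det (\matrix_(j < r, i < r) (ffpoly i).[x j]) = vdm x.
Proof.
rewrite -det_tr.
pose L := \matrix_(i < r, m < r) (ffpoly i)`_m.
have -> : (\matrix_(j < r, i < r) (ffpoly i).[x j])^T =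
    L *m Vandermonde r (\row_j x j).
  apply/matrixP => i j; rewrite !mxE (@horner_coef_wide _ r); last first.
    by rewrite size_ffpoly.
  by apply: eq_bigr => m _; rewrite !mxE.
rewrite det_mulmx det_Vandermonde det_trig; last first.
  by apply/is_trig_mxP => i j ij; rewrite mxE nth_default // size_ffpoly.
rewrite big1 => [|i _]; last first.
  have := ffpoly_monic i; rewrite monicE lead_coefE size_ffpoly /= => /eqP <-.
  by rewrite mxE.
by rewrite mul1r; apply: eq_bigr => i _; apply: eq_bigr => j _; rewrite !mxE.
Qed.

(* The falling factorials of x - 1, multiplied by x, are those of x times
   x - i, so [det_sum_rows] evaluates the sum. *)
Lemma sum_vdm_shift (r : nat) (x : 'I_r -> F) :
  \sum_l x l * vdm (upd x l (x l - 1)) = (\sum_l x l - 'C(r, 2)%:R) * vdm x.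
Proof.
pose B := \matrix_(j < r, i < r) (ffpoly i).[x j].
pose D l := \matrix_(j < r, i < r)
  if j == l then x l * (ffpoly i).[x l - 1] else (ffpoly i).[x j].
have := @det_sum_rows F r B 0 D x.
rewrite det_ffpoly [X in _ + X]big1 => [|l _]; last first.
  rewrite (expand_det_row _ l) big1 // => j _.
  by rewrite !mxE eqxx mul0r.
rewrite addr0 => <-.
- apply: eq_bigr => l _; rewrite -det_ffpoly.
  rewrite -[in LHS](det_tr) -[in RHS](det_tr).
  rewrite -det_tr trmxK -[RHS]det_tr trmxK.
  rewrite (@determinant_multilinear _ _ (D l)
    (\matrix_(j, i) (ffpoly i).[upd x l (x l - 1) j])
    (\matrix_(j, i) (ffpoly i).[upd x l (x l - 1) j]) l (x l) 0).
  + by rewrite mul0r addr0.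
  + by apply/rowP => i; rewrite !mxE eqxx upd_eq mul0r addr0.
  + apply/matrixP => i j; rewrite !mxE eq_sym (negbTE (neq_lift _ _)).
    by rewrite upd_neq // eq_sym neq_lift.
  + apply/matrixP => i j; rewrite !mxE eq_sym (negbTE (neq_lift _ _)).
    by rewrite upd_neq // eq_sym neq_lift.
- by move=> l i j il; rewrite !mxE (negbTE il).
- by move=> l j; rewrite !mxE eqxx addr0 -horner_ffpolySl horner_ffpolyS.
Qed.

Lemma vdm_upd (r : nat) (x : 'I_r -> F) l v :
  vdm x * \prod_(i | i != l) (v - x i) =
  vdm (upd x l v) * \prod_(i | i != l) (x l - x i).
Proof.
(* Only the first two products involve [y l]; the third is unaffected by the update. *)
have split_l (y : 'I_r -> F) : vdm y = \prod_(j < r | (l < j)%N) (y j - y l)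
    * \prod_(i < r | i != l) (if (i < l)%N then y l - y i else 1)
    * \prod_(i < r | i != l) \prod_(j < r | (i < j)%N && (j != l)) (y j - y i).
  rewrite /vdm (bigD1 l) //= -mulrA; congr (_ * _).
  rewrite -big_split /=; apply: eq_bigr => i il.
  case: ltnP => [lil|lli]; first by rewrite (bigD1 l).
  rewrite mul1r; apply: eq_bigl => j; case: eqP => [->|_]; last by rewrite andbT.
  by rewrite andbF; apply/negbTE; rewrite -leqNgt.
(* Orienting all differences as [y l - y i] costs a sign that depends only on the position of [l],
   hence is the same on both sides. *)
have signs (y : 'I_r -> F) : \prod_(j < r | (l < j)%N) (y j - y l)
    * \prod_(i < r | i != l) (if (i < l)%N then y l - y i else 1)
  = \prod_(i < r | i != l) (if (i < l)%N then 1 else -1)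
    * \prod_(i < r | i != l) (y l - y i).
  rewrite [X in X * _ = _](_ : _ =
    \prod_(i < r | i != l) (if (i < l)%N then 1 else y i - y l)); last first.
    rewrite [in RHS](bigID (fun i : 'I_r => (i < l)%N)) /=.
    rewrite [in RHS]big1 => [|i /andP[_ ->]//]; rewrite mul1r.
    rewrite [RHS](eq_bigr (fun i => y i - y l)) => [|i /andP[_ /negbTE->]//].
    apply: eq_bigl => i; rewrite -leqNgt [in RHS]leq_eqVlt.
    case: eqVneq => [->|il] /=; first by rewrite ltnn.
    by rewrite -(inj_eq val_inj) eq_sym in il; rewrite (negbTE il).
  rewrite -!big_split /=; apply: eq_bigr => i il.
  case: ltnP => _.
    by rewrite !mul1r.
  by rewrite mulr1 mulN1r opprB.
rewrite [vdm x]split_l signs [vdm (upd _ _ _)]split_l signs upd_eq.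
rewrite [\prod_(i < r | i != l) (v - upd x l v i)](eq_bigr (fun i => v - x i));
  last first.
  by move=> i il; rewrite upd_neq.
rewrite [X in _ = _ * X * _](_ : _ =
   \prod_(i < r | i != l) \prod_(j < r | (i < j)%N && (j != l)) (x j - x i)).
  by ring.
apply: eq_bigr => i il; apply: eq_bigr => j /andP[_ jl].
by rewrite !upd_neq.
Qed.

Lemma vdm_neq0 (r : nat) (x : 'I_r -> F) : injective x -> vdm x != 0.
Proof.
move=> xI; apply/prodf_neq0 => i _; apply/prodf_neq0 => j ij.
rewrite subr_eq0; apply: contraTneq ij => /xI ->; by rewrite ltnn.
Qed.

Lemma vdm_upd_ratio (r : nat) (x : 'I_r -> F) l v : injective x ->
  vdm (upd x l v) / vdm x = \prod_(i | i != l) ((v - x i) / (x l - x i)).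
Proof.
move=> xI; rewrite prodf_div.
have V0 := vdm_neq0 xI.
have P0 : \prod_(i | i != l) (x l - x i) != 0.
  apply/prodf_neq0 => i; rewrite subr_eq0.
  by apply: contra_neq => /xI.
by apply/eqP; rewrite eqr_div // [X in _ == X]mulrC vdm_upd.
Qed.

(** Applied below to the beta numbers inside one class, where the right side becomes the size of the
    partition of that class. *)
Lemma sum_vdm_weights (r : nat) (x : 'I_r -> F) : injective x ->
  \sum_l x l * \prod_(i | i != l) ((x l - 1 - x i) / (x l - x i)) =
  \sum_l x l - 'C(r, 2)%:R.
Proof.
move=> xI; rewrite -[RHS](mulfK (vdm_neq0 xI)) -sum_vdm_shift mulr_suml.
by apply: eq_bigr => l _; rewrite -vdm_upd_ratio // mulrA.
Qed.

End Vandermonde.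

(** * The Appell polynomials q_n *)

Section Appell.
Variables (F : numFieldType) (p : nat).
Hypothesis p_gt0 : (0 < p)%N.

Let pR0 : (p%:R : F) != 0. Proof. by rewrite pnatr_eq0 -lt0n. Qed.

Local Notation f := (gen_exponent F p).
Local Notation h := (exp_coef f).
Local Notation q := (Defs.qpoly F p).

(** The length is variable because differentiation in t shortens the sum by one; the coefficient of
    t^n is the same for all lengths above n. *)
Let expf (M : nat) : {poly {poly F}} :=
  \sum_(k < M) (k`!%:R^-1 : F)%:P *: f ^+ k.

Lemma deriv_gen_exponent : f^`() = 'X%:P - 'X^(p.-1).
Proof.
rewrite /gen_exponent derivB !derivZ derivX derivXn alg_polyC; congr (_ - _).
by rewrite -scalerMnr scalerMnl -polyCMn -[_ *+ p]mulr_natr mulVf // scale1r.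
Qed.

Lemma coef_gen_exponentX k n : (n < k)%N -> (f ^+ k)`_n = 0.
Proof.
move=> nk; have -> : f = 'X * ('X%:P - (p%:R^-1 : F)%:P *: 'X^(p.-1)).
  rewrite /gen_exponent mulrBr -scalerAr -exprS prednK //.
  by rewrite -mul_polyC mulrC.
by rewrite exprMn coefXnM nk.
Qed.

Let coef_expf M n : (n < M)%N -> (expf M)`_n = h n.
Proof.
move=> nM; rewrite /expf /exp_coef -(subnKC nM) big_split_ord /= coefD.
rewrite [X in _ + X]coef_sum [X in _ + X]big1 ?addr0 // => k _.
by rewrite coefZ coef_gen_exponentX ?mulr0 // leq_addr.
Qed.

Let deriv_expf M : (expf M.+1)^`() = f^`() * expf M.
Proof.
rewrite /expf raddf_sum /= big_ord_recl /= derivZ expr0 derivC scaler0 add0r.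
rewrite mulr_sumr; apply: eq_bigr => k _.
rewrite derivZ deriv_exp /= -scalerAr /bump /= add1n.
rewrite -scalerMnr scalerMnl -polyCMn; congr (_%:P *: _).
by rewrite -[LHS]mulr_natr factS natrM invfM mulrAC mulVf ?mul1r // pnatr_eq0.
Qed.

(** Coefficient of t^n in d/dt exp(f) = f' exp(f), where f' = x - t^(p-1). *)
Lemma exp_coef_rec n : n.+1%:R * h n.+1 =
  'X * h n - (if (p <= n.+1)%N then h (n.+1 - p) else 0).
Proof.
have := congr1 (fun g : {poly {poly F}} => g`_n) (deriv_expf n.+1).
rewrite /= coef_deriv coef_expf // deriv_gen_exponent mulrBl coefB coefCM coefXnM.
rewrite coef_expf // mulr_natl => ->; congr (_ - _).
have -> : (n < p.-1)%N = ~~ (p <= n.+1)%N by lia.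
by case: leqP => //= pn; rewrite coef_expf; [congr h|]; lia.
Qed.

Lemma exp_coef0 : h 0 = 1.
Proof.
by rewrite /exp_coef big_ord1 coefZ expr0 coef1 mulr1 fact0 invr1.
Qed.

(** The Appell property. Differentiating the recursion for [h n.+1] leaves [h n] plus the right side
    of the recursion one step lower, that is, n times [h n]. *)
Lemma deriv_exp_coef n : (h n)^`() = if n is n'.+1 then h n' else 0.
Proof.
elim/ltn_ind: n => -[|n] IH; first by rewrite exp_coef0 derivC.
have N0 : (n.+1%:R : {poly F}) != 0 by rewrite -polyC_natr polyC_eq0 pnatr_eq0.
apply: (mulfI N0); rewrite [LHS]mulr_natl -derivMn -[h n.+1 *+ _]mulr_natl exp_coef_rec.
rewrite derivB derivM derivX mul1r IH //.
have -> : (if (p <= n.+1)%N then h (n.+1 - p) else 0)^`() =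
    if (p <= n)%N then h (n - p) else 0.
  case: (leqP p n) => pn; first by rewrite leqW // IH ?subSn //; lia.
  case: leqP => pn1; last by rewrite deriv0.
  (* Here p = n + 1, and the derivative falls on the constant [h 0]. *)
  by rewrite (_ : n.+1 - p = 0)%N ?IH //; lia.
case: n {IH N0} => [|n]; first by rewrite leqNgt p_gt0 /= mulr0 addr0 subr0 mul1r.
by rewrite -addrA -exp_coef_rec -[n.+2%:R]natr1 mulrDl mul1r addrC.
Qed.

(** The recursion multiplied by (n-1)!, combined with the Appell property. For n < p the truncated
    index [n - p] is harmless, as the falling factorial vanishes. *)
Lemma qpoly_euler n :
  'X * (q n)^`() = n%:R * q n + (n ^_ p)%:R * q (n - p).
Proof.
rewrite /Defs.qpoly derivZ deriv_exp_coef -scalerAr.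
case: n => [|n].
  by rewrite mulr0 scaler0 mul0r ffact_small ?p_gt0 // mul0r addr0.
rewrite -[n.+1%:R * _]scalerAr exp_coef_rec // scalerBr -addrA -[LHS]addr0.
congr (_ + _); symmetry.
case: leqP => pn; last by rewrite scaler0 oppr0 ffact_small // mul0r addr0.
rewrite -(ffact_fact pn) natrM -scalerA [X in _ + X]mulr_natl.
by rewrite [X in - X]scaler_nat addNr.
Qed.

(** Each further derivative passes ['X] at the cost of one extra term, which lowers the factor n - i
    by one. This is the form required by [det_sum_rows]. *)
Lemma derivn_qpoly_euler n i :
  'X * (q n)^`(i)^`() =
  (n%:R - i%:R) * (q n)^`(i) + (n ^_ p)%:R * (q (n - p))^`(i).
Proof.
elim: i => [|i IH]; first by rewrite subr0 !derivn0 qpoly_euler.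
rewrite !derivnS; have := congr1 (@deriv F) IH.
rewrite derivM derivX mul1r derivD !mulr_natl.
rewrite -[(n%:R - i%:R)]/(n%:R - i%:R) mulrBl !mulr_natl derivB !derivMn.
move/(canRL (addKr _)) => ->.
by rewrite mulrBl !mulr_natl mulrSr; ring.
Qed.

Lemma size_qpoly n : (size (q n) <= n.+1)%N /\ (q n)`_n = 1.
Proof.
rewrite /Defs.qpoly; elim/ltn_ind: n => -[|n] IH.
  by rewrite fact0 scale1r exp_coef0 size_poly1 coef1; split.
have qS : (n.+1)`!%:R *: h n.+1 = 'X * (n`!%:R *: h n) -
    n`!%:R *: (if (p <= n.+1)%N then h (n.+1 - p) else 0).
  rewrite -scalerAr -scalerBr -exp_coef_rec factS mulnC natrM -scalerA.
  by congr (_ *: _); rewrite scaler_nat [RHS]mulr_natl.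
have [sn cn] := IH n (ltnSn _).
have small : (size (n`!%:R *: (if (p <= n.+1)%N then h (n.+1 - p) else 0)%R)
    <= n.+1)%N.
  case: (leqP p n.+1) => pn; last by rewrite scaler0 size_poly0.
  rewrite size_scale ?pnatr_eq0 -?lt0n ?fact_gt0 //.
  have [|+ _] := IH (n.+1 - p)%N; first by lia.
  rewrite size_scale ?pnatr_eq0 -?lt0n ?fact_gt0 // => /leq_trans; apply; lia.
rewrite qS; split.
  apply: leq_trans (size_polyD _ _) _; rewrite geq_max size_polyN; apply/andP.
  split; last exact: leqW.
  by rewrite (leq_trans (size_polyMleq _ _)) // size_polyX.
by rewrite coefB coefXM /= cn [X in _ - X]nth_default ?subr0.
Qed.

End Appell.

(** * The recursion for the Wronskian *)

Lemma deriv_prod (A : comNzRingType) (J : finType) (f : J -> {poly A}) :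
  (\prod_j f j)^`() = \sum_l (f l)^`() * \prod_(j | j != l) f j.
Proof.
suff deriv_seq (s : seq J) : uniq s -> (\prod_(j <- s) f j)^`() =
    \sum_(l <- s) (f l)^`() * \prod_(j <- s | j != l) f j.
  exact/deriv_seq/index_enum_uniq.
elim: s => [|x s IH] /=; first by rewrite !big_nil derivC.
case/andP=> xs us; rewrite !big_cons derivM IH //= eqxx /=.
congr (_ * _ + _).
  by rewrite big_seq_cond [RHS]big_seq_cond; apply: eq_bigl => y;
     case: eqP => [->|]; rewrite ?(negbTE xs) // !andbT.
rewrite mulr_sumr big_seq [RHS]big_seq; apply: eq_bigr => y ys.
rewrite big_cons; case: eqP => [xy|_] /=; first by rewrite xy ys in xs.
by rewrite mulrCA.
Qed.

Lemma deriv_det (A : comNzRingType) (r : nat) (B : 'M[{poly A}]_r) :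
  'X * (\det B)^`() =
  \sum_l \det (\matrix_(i, j) if i == l then 'X * (B i j)^`() else B i j).
Proof.
rewrite /determinant exchange_big /= raddf_sum mulr_sumr; apply: eq_bigr => s _ /=.
have sgn0 : ((-1) ^+ s : {poly A})^`() = 0.
  by case: (odd_perm s); rewrite ?derivN derivC ?oppr0.
rewrite derivM sgn0 mul0r add0r mulrCA -mulr_sumr; congr (_ * _).
rewrite deriv_prod mulr_sumr; apply: eq_bigr => l _.
rewrite [RHS](bigD1 l) //= mxE eqxx mulrA; congr (_ * _).
by apply: eq_bigr => i il; rewrite mxE (negbTE il).
Qed.

Lemma det_row_scale (A : comPzRingType) (r : nat) (B : 'M[A]_r) l g :
  \det (\matrix_(i, j) if i == l then g * B i j else B i j) = g * \det B.
Proof.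
rewrite /determinant mulr_sumr; apply: eq_bigr => s _.
rewrite mulrCA; congr (_ * _).
rewrite (bigD1 l) //= mxE eqxx [in RHS](bigD1 l) //= mulrA; congr (_ * _).
by apply: eq_bigr => i il; rewrite mxE (negbTE il).
Qed.

Lemma coef_prod_top (A : comNzRingType) (J : finType) (f : J -> {poly A})
    (d : J -> nat) : (forall j, size (f j) <= (d j).+1)%N ->
  (\prod_j f j)`_(\sum_j d j) = \prod_j (f j)`_(d j).
Proof.
move=> sf; suff: (size (\prod_j f j)%R <= (\sum_j d j).+1)%N /\
  (\prod_j f j)`_(\sum_j d j) = \prod_j (f j)`_(d j) by case.
elim/big_ind3: _ => [|g m a g' m' a' [sg <-] [sg' <-]|j _]; last by split.
  by rewrite size_poly1 coef1.
split; first by rewrite (leq_trans (size_polyMleq _ _)) //; lia.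
rewrite coefM (bigD1 (inord m)) //= inordK ?ltnS ?leq_addr // addKn.
rewrite big1 ?addr0 // => i im.
have {im} : (i : nat) != m.
  by apply: contra_neq im => im; apply: val_inj; rewrite /= inordK ?ltnS ?leq_addr.
rewrite neq_ltn => /orP[im|mi]; last by rewrite nth_default ?mul0r // (leq_trans sg).
by rewrite [X in _ * X]nth_default ?mulr0 // (leq_trans sg') //; lia.
Qed.

Lemma ord_sum_bin (r : nat) : (\sum_(i < r) i = 'C(r, 2))%N.
Proof. by rewrite -bin2_sum big_mkord. Qed.

Section Weights.
Variables (F : fieldType) (p : nat).

(** For distinct values in [F] the product is the ratio of the Vandermonde products after and before
    [n l] is lowered by p, the subtraction being done in [F], without truncation. *)
Definition weight (J : finType) (n : J -> nat) (l : J) : F :=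
  (n l ^_ p)%:R * \prod_(x | x != l)
    (((n l)%:R - p%:R - (n x)%:R) / ((n l)%:R - (n x)%:R)).

(* The coefficient of x^(|lambda| - p j) in q_lambda, for the beta numbers [n]
   of lambda.  The truncation in [n l - p] and the zero denominators for
   colliding beta numbers are harmless: [weight] vanishes on the moves that
   would produce them. *)
Fixpoint rcoef (j : nat) (J : finType) (n : J -> nat) : F :=
  if j is j'.+1
  then - (\sum_l weight n l * rcoef j' (upd n l (n l - p)%N)) / (p * j'.+1)%:R
  else 1.

(** Allows the beta numbers, indexed by rows, to be relabelled by base and excited elements of the
    p-quotient. *)
Lemma rcoef_bij (J J' : finType) (g : J -> J') j (n : J' -> nat) :
  bijective g -> rcoef j (n \o g) = rcoef j n.
Proof.
move=> gB; have gI := bij_inj gB.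
elim: j n => [//|j IH] n /=; congr (- _ / _).
rewrite [RHS](reindex g) /=; last exact: onW_bij.
apply: eq_bigr => l _; congr (_ * _).
  rewrite /weight [in RHS](reindex g) /=; last exact: onW_bij.
  by congr (_ * _); apply: eq_bigl => x; rewrite (inj_eq gI).
rewrite -IH; congr rcoef; apply/funext => x.
by rewrite /= /upd (inj_eq gI).
Qed.

End Weights.

Section Wronskian.
Variables (F : numFieldType) (p : nat).
Hypothesis p_gt0 : (0 < p)%N.

Local Notation q := (Defs.qpoly F p).

(** Stated for arbitrary index families: lowering one index by p may destroy the order or create
    repetitions. *)
Definition wr (r : nat) (n : 'I_r -> nat) : {poly F} :=
  \det (\matrix_(j, i) (q (n j))^`(i)).

Definition vdmn (r : nat) (n : 'I_r -> nat) : F := vdm (fun j => (n j)%:R).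

Lemma wr_euler (r : nat) (n : 'I_r -> nat) :
  'X * (wr n)^`() = ((\sum_l n l)%:R - 'C(r, 2)%:R) * wr n
    + \sum_l (n l ^_ p)%:R * wr (upd n l (n l - p)%N).
Proof.
rewrite /wr deriv_det.
rewrite (@det_sum_rows _ _ (\matrix_(j, i) (q (n j))^`(i))
  (\matrix_(j, i) ((n j ^_ p)%:R * (q (n j - p))^`(i))) _
  (fun l => (n l)%:R)).
- rewrite -natr_sum; congr (_ + _); apply: eq_bigr => l _.
  rewrite -(det_row_scale _ l); congr (\det _); apply/matrixP => j i.
  by rewrite !mxE /upd; case: eqP.
- by move=> l i j il; rewrite mxE (negbTE il).
- by move=> l j; rewrite !mxE eqxx derivn_qpoly_euler.
Qed.

Lemma det_eq_rows (A : comPzRingType) (r : nat) (m : nat -> 'I_r -> A)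
    (n : 'I_r -> nat) : ~~ injectiveb n -> \det (\matrix_(j, i) m (n j) i) = 0.
Proof.
case/injectivePn => x [y xy nxy]; apply: (determinant_alternate xy) => i.
by rewrite !mxE nxy.
Qed.

Lemma wr_eq0 (r : nat) (n : 'I_r -> nat) : ~~ injectiveb n -> wr n = 0.
Proof. exact: (det_eq_rows (fun m i => (q m)^`(i))). Qed.

Lemma vdmn_eq0 (r : nat) (n : 'I_r -> nat) : ~~ injectiveb n -> vdmn n = 0.
Proof.
rewrite /vdmn -det_ffpoly.
exact: (det_eq_rows (fun m (i : 'I_r) => (ffpoly F i).[m%:R])).
Qed.

Lemma vdmn_neq0 (r : nat) (n : 'I_r -> nat) : injective n -> vdmn n != 0.
Proof. by move=> nI; apply: vdm_neq0 => x y /eqP; rewrite eqr_nat => /eqP/nI. Qed.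

Lemma wr_coef_eq (r : nat) (n : 'I_r -> nat) e :
  (e%:R + 'C(r, 2)%:R - (\sum_l n l)%:R) * (wr n)`_e =
  \sum_l (n l ^_ p)%:R * (wr (upd n l (n l - p)%N))`_e.
Proof.
have := congr1 (fun g : {poly F} => g`_e) (wr_euler n).
rewrite /= coefXM coefD coef_sum.
under [X in _ = _ + X]eq_bigr do rewrite -polyC_natr coefCM.
rewrite -!polyC_natr -polyCB coefCM => E.
apply: (addrI (((\sum_l n l)%:R - 'C(r, 2)%:R) * (wr n)`_e)); rewrite -E.
suff -> : (if e == 0%N then 0 else (wr n)^`()`_e.-1) = e%:R * (wr n)`_e by ring.
by case: e {E} => [|e]; rewrite ?mul0r //= coef_deriv mulr_natl.
Qed.

Lemma sum_upd_sub (r : nat) (n : 'I_r -> nat) l : (p <= n l)%N ->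
  (\sum_x upd n l (n l - p)%N x + p = \sum_x n x)%N.
Proof. by move=> pn; have := sum_upd n l (n l - p)%N; lia. Qed.

(** Strong induction on the sum of the indices: every move lowers the sum, and the scalar in
    [wr_coef_eq] is non-zero in this range. *)
Lemma wr_coef_big (r : nat) (n : 'I_r -> nat) e :
  (\sum_l n l < 'C(r, 2) + e)%N -> (wr n)`_e = 0.
Proof.
have [m] := ubnP (\sum_l n l); elim: m n => // m IH n nm ne.
have N0 : e%:R + 'C(r, 2)%:R - (\sum_l n l)%:R != 0 :> F.
  by rewrite -natrD subr_eq0 eqr_nat; lia.
apply: (mulfI N0); rewrite mulr0 wr_coef_eq big1 // => l _.
have [nl|nl] := ltnP (n l) p; first by rewrite ffact_small // mul0r.
by rewrite IH ?mulr0 //; have := sum_upd_sub nl; lia.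
Qed.

(** In top degree a Leibniz term contributes only the leading coefficients of its factors; these are
    falling factorials, so the sum is the determinant of [det_ffpoly]. *)
Lemma wr_coef_top (r : nat) (n : 'I_r -> nat) e :
  (\sum_l n l = 'C(r, 2) + e)%N -> (wr n)`_e = vdmn n.
Proof.
move=> ne; rewrite /vdmn -det_ffpoly /wr /determinant coef_sum.
apply: eq_bigr => s _.
rewrite (_ : ((-1) ^+ s : {poly F}) = ((-1) ^+ s)%:P); last first.
  by rewrite polyC_exp polyCN.
rewrite coefCM; congr (_ * _).
under [RHS]eq_bigr do rewrite mxE horner_ffpoly_nat.
rewrite (eq_bigr (fun j => (q (n j))^`(s j))) => [|j _]; last by rewrite mxE.
have [/forallP/= sn|] := boolP [forall j, s j <= n j]%N.
  have -> : e = (\sum_j (n j - s j))%N.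
    have sC : (\sum_j s j = 'C(r, 2))%N.
      by rewrite -ord_sum_bin [RHS](reindex_inj (@perm_inj _ s)).
    have : (\sum_j (n j - s j) + \sum_j s j = \sum_j n j)%N.
      by rewrite -big_split /=; apply: eq_bigr => j _; rewrite subnK.
    by rewrite sC ne addnC => /addnI.
  rewrite coef_prod_top => [|j].
    apply: eq_bigr => j _; rewrite coef_derivn subnKC //.
    by have [_ ->] := size_qpoly F p_gt0 (n j).
  apply/leq_sizeP => i ij; rewrite coef_derivn nth_default ?mul0rn //.
  have [sz _] := size_qpoly F p_gt0 (n j).
  by apply: leq_trans sz _; have := sn j; lia.
(* More derivatives than the degree: the polynomial factor and the falling factorial both vanish. *)
rewrite negb_forall => /existsP[j]; rewrite -ltnNge => nj.
rewrite (bigD1 j) //= derivn_poly0 ?mul0r ?coef0; last first.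
  by have [sz _] := size_qpoly F p_gt0 (n j); apply: leq_trans sz _.
by rewrite (bigD1 j) //= ffact_small // mul0r.
Qed.

Lemma wr_coef (r : nat) (n : 'I_r -> nat) j e : injective n ->
  (\sum_l n l = 'C(r, 2) + e + p * j)%N -> (wr n)`_e = vdmn n * rcoef F p j n.
Proof.
elim: j n => [|j IH] n nI nE.
  by rewrite mulr1 (wr_coef_top (e := e)) // nE muln0 addn0.
have pj0 : (p * j.+1)%:R != 0 :> F by rewrite pnatr_eq0; lia.
apply: (mulfI pj0); rewrite /= mulrCA [_%:R * (_ / _)]mulrC divfK //.
rewrite mulrN mulr_sumr -[LHS]opprK -mulNr.
have -> : - (p * j.+1)%:R = e%:R + 'C(r, 2)%:R - (\sum_l n l)%:R :> F.
  by rewrite nE !natrD; ring.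
rewrite wr_coef_eq; congr (- _); apply: eq_bigr => l _.
have xI : injective (fun i => (n i)%:R : F).
  by move=> x y /eqP; rewrite eqr_nat => /eqP/nI.
have [nl|nl] := ltnP (n l) p; first by rewrite /weight ffact_small // !(mul0r, mulr0).
have -> : weight F p n l = (n l ^_ p)%:R * (vdmn (upd n l (n l - p)%N) / vdmn n).
  rewrite /weight -natrB // -(vdm_upd_ratio l (n l - p)%:R xI).
  congr (_ * (vdm _ / _)); apply/funext => x; rewrite /upd.
  by case: ifP.
have [/injectiveP uI|uN] := boolP (injectiveb (upd n l (n l - p)%N)).
  rewrite IH //; last by have := sum_upd_sub nl; lia.
  by field; apply: vdmn_neq0.
(* Two indices collide: the determinant has equal rows, and the weight vanishes with the Vandermonde
   product. *)
by rewrite (wr_eq0 uN) (vdmn_eq0 uN) coef0 !(mul0r, mulr0).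
Qed.

End Wronskian.

(** * Weights of excited elements *)

Section Excitations.
Variables (F : numFieldType) (p : nat).
Hypothesis p_gt0 : (0 < p)%N.
Variable ell : 'I_p -> nat.

Local Notation exc := {i : 'I_p & 'I_(ell i)}.

(** Only collisions inside a class matter, since different classes occupy different residues mod
    p. *)
Definition tag_injective (beta : exc -> nat) : Prop :=
  forall y y', tag y = tag y' -> beta y = beta y' -> y = y'.

(* [beta (i, k)] is the height of the k-th excited element of class i above the
   lowest excited position; that position is written [u i] below, so the beta
   number of [y] is [u (tag y) + p * beta y]. *)
Definition class_weight (beta : exc -> nat) (y : exc) : F :=
  (beta y)%:R * \prod_(y' | (y' != y) && (tag y' == tag y))
    (((beta y)%:R - 1 - (beta y')%:R) / ((beta y)%:R - (beta y')%:R)).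

(** Here [v] is the distance between the bottoms of the two classes. The leading factor is what
    telescoping leaves of the base of class [i]; the product runs over its excited elements. *)
Definition cross_weight (v : int) (beta : exc -> nat) (y : exc) (i : 'I_p) : F :=
  (v%:~R + (p * beta y)%:R) * \prod_(y' | tag y' == i)
    (1 - p%:R / (v%:~R + (p * beta y)%:R - (p * beta y')%:R)).

Definition exc_weight (u : 'I_p -> int) (beta : exc -> nat) (y : exc) : F :=
  p%:R * class_weight beta y
  * \prod_(i | i != tag y) cross_weight (u (tag y) - u i) beta y i.

(** The recursion of [rcoef] restricted to moves of excited elements. It sees the base only through
    the bottoms [u], so [beta] can stay fixed while [u] varies with k. *)
Fixpoint ecoef (j : nat) (u : 'I_p -> int) (beta : exc -> nat) : F :=
  if j is j'.+1
  then - (\sum_y exc_weight u beta y * ecoef j' u (upd beta y (beta y).-1))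
       / (p * j'.+1)%:R
  else 1.

(** A move below height 0 is killed by the leading factor, and a move onto an occupied height by the
    numerator of that element. *)
Lemma class_weight_neq0 beta y : tag_injective beta -> class_weight beta y != 0 ->
  (0 < beta y)%N /\ tag_injective (upd beta y (beta y).-1).
Proof.
move=> bI; rewrite mulf_eq0 negb_or pnatr_eq0 -lt0n => /andP[b0 /prodf_neq0 w0].
have key y' : y' != y -> tag y' = tag y -> beta y' != (beta y).-1.
  move=> yy' ty; have := w0 y'; rewrite yy' ty eqxx => /(_ isT).
  by apply: contra_neq => ->; rewrite -subn1 natrB // subrr mul0r.
split=> // y1 y2; rewrite /upd; case: eqP => [->|/eqP n1];
  case: eqP => [->|/eqP n2] // ty.
- by move/esym/eqP; rewrite (negbTE (key _ n2 _)).
- by move/eqP; rewrite (negbTE (key _ n1 _)).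
- exact: bI.
Qed.

Variables (e N : 'I_p -> nat).
Hypotheses (e_lt : forall i, (e i < p)%N) (e_inj : injective e).

Local Notation base := {i : 'I_p & 'I_(N i)}.

(** Class [i] occupies the residue [e i] mod p: the base fills its first [N i] places without gaps,
    and excited heights are counted from there. *)
Definition position (beta : exc -> nat) (x : base + exc) : nat :=
  match x with
  | inl y => e (tag y) + p * tagged y
  | inr y => e (tag y) + p * (N (tag y) + beta y)
  end.

Let eq_mod i i' a b : (e i + p * a = e i' + p * b)%N -> i = i' /\ a = b.
Proof.
move=> E; have ii : i = i'.
  apply: e_inj; have := congr1 (fun m => m %% p)%N E.
  by rewrite /= ![(_ + p * _)%N]addnC ![(p * _)%N]mulnC !modnMDl !modn_small.
split=> //; move: E; rewrite ii => /addnI/eqP.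
by rewrite eqn_pmul2l // => /eqP.
Qed.

Lemma position_inj beta : tag_injective beta -> injective (position beta).
Proof.
move=> bI [y|y] [y'|y'] /= /eq_mod[t E].
- case: y y' t E => [i k] [i' k'] /= ii; case: i' / ii k' => k' /= kk.
  by congr (inl (Tagged _ _)); apply: val_inj.
- by have := ltn_ord (tagged y); rewrite E -t ltnNge leq_addr.
- by have := ltn_ord (tagged y'); rewrite -E t ltnNge leq_addr.
- by congr inr; apply: bI => //; move: E; rewrite t => /addnI.
Qed.

Let u (i : 'I_p) : int := (e i + p * N i)%N.

(** The place just below a base element is occupied by another base element, except at the very
    bottom, where the position is less than p and the falling factorial vanishes. *)
Lemma weight_base beta y : weight F p (position beta) (inl y) = 0.
Proof.
rewrite /weight /=; case: y => i [[|m] mN] /=.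
  by rewrite muln0 addn0 ffact_small // mul0r.
rewrite (bigD1 (inl (Tagged (fun i => 'I_(N i)) (Ordinal (ltnW mN)))))/=.
  rewrite [X in X / _](_ : _ = 0) ?(mul0r, mulr0) //.
  by rewrite mulnS !natrD; ring.
apply/eqP => /(congr1 (fun x : base + exc =>
  if x is inl y then nat_of_ord (tagged y) else 0%N)) /=; lia.
Qed.

(** The numerator at m equals the denominator at m + 1; the factor [z - a] cancels the first
    denominator. *)
Lemma prod_telescope (z a : F) (M : nat) :
  (forall m, (m < M)%N -> z != a + (p * m)%:R) ->
  (z - a) * \prod_(m < M) ((z - p%:R - (a + (p * m)%:R)) / (z - (a + (p * m)%:R)))
  = z - (a + (p * M)%:R).
Proof.
elim: M => [|M IH] zM; first by rewrite big_ord0 mulr1 muln0 addr0.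
rewrite big_ord_recr /= mulrA IH => [|m mM]; last by apply: zM; apply: ltnW.
rewrite mulrC mulfVK ?subr_eq0 ?zM // mulnS natrD; ring.
Qed.

Lemma weight_exc beta y : tag_injective beta ->
  weight F p (position beta) (inr y) = exc_weight u beta y.
Proof.
move=> bI; have pR0 : (p%:R : F) != 0 by rewrite pnatr_eq0 -lt0n.
have posI := position_inj bI.
have posR x x' : (position beta x)%:R = (position beta x')%:R :> F -> x = x'.
  by move/eqP; rewrite eqr_nat => /eqP/posI.
set z : F := (position beta (inr y))%:R.
have zE : z = (u (tag y))%:~R + (p * beta y)%:R.
  by rewrite /z /u /= -pmulrn mulnDr addnA natrD.
pose exc_factor i := \prod_(y' | (y' != y) && (tag y' == i))
  ((z - p%:R - (position beta (inr y'))%:R) / (z - (position beta (inr y'))%:R)).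
have -> : weight F p (position beta) (inr y) =
    \prod_i ((z - (u i)%:~R) * exc_factor i).
  rewrite /weight big_sumType /=.
  rewrite [X in _ * (_ * X) = _](partition_big tag predT) //= -/z.
  rewrite [X in _ * (X * _) = _](_ : _ = \prod_i \prod_(m < N i)
      ((z - p%:R - ((e i)%:R + (p * m)%:R)) / (z - ((e i)%:R + (p * m)%:R)))).
    rewrite -horner_ffpoly_nat horner_ffpoly -/z.
    (* [e] permutes the residues, so the falling factorial of z is the product of all [z - e i];
       each factor starts the telescoping product of its class. *)
    pose e' i := Ordinal (e_lt i).
    rewrite (reindex_inj (h := e')) /=; last by move=> i i' [] /e_inj.
    rewrite mulrA -!big_split /=; apply: eq_bigr => i _; congr (_ * _).
    rewrite prod_telescope => [|m mN]; first by rewrite /u -pmulrn natrD.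
    apply/eqP => zm.
    have /posR// : z = (position beta (inl (Tagged (fun i => 'I_(N i)) (Ordinal mN))))%:R.
    by rewrite /= natrD.
  rewrite [RHS](sig_big_dep _ _ (fun i (m : 'I_(N i)) =>
    ((z - p%:R - ((e i)%:R + (p * m)%:R)) / (z - ((e i)%:R + (p * m)%:R))))) /=.
  by apply: eq_bigr => x _; rewrite natrD.
(* In the class of [y] itself, z minus the bottom is [p * beta y], and p cancels from every
   ratio. *)
rewrite (bigD1 (tag y)) //= /exc_weight; congr (_ * _).
  rewrite /class_weight mulrA; congr (_ * _).
    by rewrite zE addrAC subrr add0r natrM.
  apply: eq_bigr => y' /andP[yy' /eqP ty].
  have nz : (beta y)%:R - (beta y')%:R != 0 :> F.
    rewrite subr_eq0 eqr_nat; apply: contra_neq yy' => bb.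
    by apply: bI.
  rewrite zE /= ty mulnDr addnA natrD /u -pmulrn !natrM.
  rewrite [X in X / _ = _](_ : _ = p%:R * ((beta y)%:R - 1 - (beta y')%:R)); last by ring.
  rewrite [X in _ / X = _](_ : _ = p%:R * ((beta y)%:R - (beta y')%:R)); last by ring.
  by rewrite invfM mulrACA divff // mul1r.
apply: eq_bigr => i iy; rewrite /cross_weight; congr (_ * _).
  by rewrite zE rmorphB /=; ring.
apply: eq_big => [y'|y' /andP[yy' /eqP ty]].
  by rewrite andbC; case: eqP => //= ty; apply: contraNneq iy => <-; rewrite ty.
have nz : z - (position beta (inr y'))%:R != 0.
  by rewrite subr_eq0; apply: contra_neq yy' => /posR[].
have -> : (u (tag y) - u i)%:~R + (p * beta y)%:R - (p * beta y')%:R =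
    z - (position beta (inr y'))%:R.
  by rewrite zE /= ty mulnDr addnA [in RHS]natrD rmorphB /= /u -!pmulrn; ring.
by rewrite addrAC mulrBl divff.
Qed.

Lemma rcoef_position j beta : tag_injective beta ->
  rcoef F p j (position beta) = ecoef j u beta.
Proof.
elim: j beta => [//|j IH] beta bI /=; congr (- _ / _).
rewrite big_sumType /= big1 ?add0r => [|y _]; last by rewrite weight_base mul0r.
apply: eq_bigr => y _; rewrite weight_exc //.
have [w0|w0] := eqVneq (class_weight beta y) 0.
  by rewrite /exc_weight w0 mulr0 !mul0r.
have [b0 uI] := class_weight_neq0 bI w0.
rewrite -IH //; congr (_ * rcoef _ _ _ _); apply/funext => x.
rewrite /upd; case: x => [x|x] //=.
case: (eqVneq x y) => [->|xy] /=.
  (* Since [beta y] is positive, lowering the position by p is the same as lowering the height by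
     one. *)
  by rewrite eqxx; case: (beta y) b0 => // b _ /=; rewrite !mulnDr mulnS; lia.
by rewrite ifF //; apply/eqP => -[] /eqP; rewrite (negbTE xy).
Qed.

End Excitations.

(** * Beta numbers and the p-quotient *)

Section Partitions.
Variable l : intpart.
Local Notation r := (plength l).

Lemma part_out k : (r <= k)%N -> part l k = 0%N.
Proof. by move=> rk; rewrite /part nth_default. Qed.

Lemma part_gt0 k : (k < r)%N -> (0 < part l k)%N.
Proof.
case: l => s sP /= ks; have /andP[_ s0] := sP; rewrite lt0n.
by apply: contraNneq s0 => <-; apply: mem_nth.
Qed.

Lemma part_anti i j : (i <= j)%N -> (part l j <= part l i)%N.
Proof.
move=> ij; have [rj|jr] := leqP r j; first by rewrite part_out.
rewrite /part; case: l jr => s sP /= js; have /andP[ss _] := sP.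
apply: (sorted_leq_nth (leT := geq)) (ij) => //.
- by move=> ? ? ?; rewrite /geq /= => ab bc; apply: leq_trans bc ab.
- exact: leqnn.
- by rewrite inE (leq_ltn_trans ij).
Qed.

Lemma beta_num_gt0 k : (k < r)%N -> (0 < beta_num l k)%N.
Proof. by move=> kr; have := part_gt0 kr; rewrite /beta_num; lia. Qed.

Lemma beta_num_lt i j : (i < j < r)%N -> (beta_num l j < beta_num l i)%N.
Proof.
move=> /andP[ij jr]; have := part_anti (ltnW ij).
by rewrite /beta_num; lia.
Qed.

Lemma beta_num_inj : injective (fun k : 'I_r => beta_num l k).
Proof.
move=> i j bij; apply: val_inj => /=.
have [ij|ji|//] := ltngtP i j.
  by have := @beta_num_lt i j; rewrite ij ltn_ord bij ltnn => /(_ isT).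
by have := @beta_num_lt j i; rewrite ji ltn_ord bij ltnn => /(_ isT).
Qed.

Lemma sum_beta_num : (\sum_(k < r) beta_num l k = 'C(r, 2) + psize l)%N.
Proof.
rewrite /psize sumnE (big_nth 0%N) big_mkord -ord_sum_bin.
rewrite [X in (X + _)%N](reindex_inj rev_ord_inj) /= -big_split /=.
by apply: eq_bigr => k _; rewrite /beta_num -addnBA ?ltn_ord // addnC.
Qed.

(** Indices past the length fill the half-line below -r; the others give the beta numbers shifted by
    -r. *)
Lemma mayaP (z : int) : maya l z <->
  (z < - r%:Z \/ exists k : 'I_r, z = (beta_num l k)%:Z - r%:Z).
Proof.
split=> [[k ->]|[zr|[k ->]]].
- have [rk|kr] := leqP r k; first by left; rewrite part_out //; lia.
  by right; exists (Ordinal kr); rewrite /beta_num /=; lia.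
- by exists (absz z).-1; rewrite part_out; lia.
- by exists k; have := ltn_ord k; rewrite /beta_num; lia.
Qed.

End Partitions.

Section Quotient.
Variables (p : nat) (l : intpart) (c : 'I_p -> int) (mu : 'I_p -> intpart).
Local Notation r := (plength l).
Hypotheses (p_gt0 : (0 < p)%N) (lcmu : char_quotient l c mu).

Definition mu_beta (y : {i : 'I_p & 'I_(plength (mu i))}) : nat :=
  beta_num (mu (tag y)) (tagged y).

Lemma mu_beta_inj : tag_injective mu_beta.
Proof.
case=> i k [i' k'] /= ii; case: i' / ii k' => k' /beta_num_inj kk.
by move: kk => /= ->.
Qed.

Lemma maya_quotient (i : 'I_p) (m : int) : maya l (p%:Z * m + i%:Z) <->
  (m < c i - (plength (mu i))%:Z \/ exists k : 'I_(plength (mu i)),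
     m = c i - (plength (mu i))%:Z + (beta_num (mu i) k)%:Z).
Proof.
have -> : maya l (p%:Z * m + i%:Z) = maya (mu i) (m - c i).
  have := congr1 (fun S : set int => S m) (lcmu i).
  rewrite /maya_residue /translate /= => ->; apply/propext; split.
    by case=> s ms <-; rewrite addrK.
  by move=> mm; exists (m - c i); rewrite ?subrK.
rewrite mayaP; split=> -[mk|[k mk]].
- by left; lia.
- by right; exists k; lia.
- by left; lia.
- by right; exists k; lia.
Qed.

(** Shifted by the length of [l], the lowest excited place of class [i] is a natural number;
    Euclidean division by p gives its residue [e i] and the number [N i] of base elements below
    it. *)
Lemma quotient_position : exists (e N : 'I_p -> nat),
  [/\ forall i, (e i < p)%N, injective e,
      forall i, (e i + p * N i)%:Z =
        p%:Z * (c i - (plength (mu i))%:Z) + i%:Z + (plength l)%:Z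
    & exists2 f : 'I_(plength l) ->
        {i : 'I_p & 'I_(N i)} + {i : 'I_p & 'I_(plength (mu i))},
      bijective f & forall k : 'I_(plength l), beta_num l k = position e mu_beta (f k)].
Proof.
pose U i := p%:Z * (c i - (plength (mu i))%:Z) + i%:Z.
have U_ge i : - r%:Z <= U i.
  rewrite leNgt; apply/negP => Ur.
  (* Otherwise [U i] would be occupied, which requires an excited element of height 0; but beta
     numbers are positive, as all parts are. *)
  have /maya_quotient[|[k]] : maya l (U i) by apply/mayaP; left.
    by rewrite ltxx.
  by have := beta_num_gt0 (ltn_ord k); lia.
pose V i := absz (U i + r%:Z).
have VE i : (V i)%:Z = U i + r%:Z by rewrite /V; have := U_ge i; lia.
pose e i := (V i %% p)%N; pose N i := (V i %/ p)%N.
have eN i : (e i + p * N i)%N = V i by rewrite /e /N addnC mulnC -divn_eq.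
have e_lt i : (e i < p)%N by rewrite ltn_mod.
(* [e i] is congruent to i + r mod p. *)
have e_inj : injective e.
  move=> i j eij; apply: val_inj => /=.
  have := VE i; have := VE j; rewrite -!eN eij /U.
  have := ltn_ord i; have := ltn_ord j; clear - p_gt0 => jp ip Hj Hi.
  have [m mE] : exists m : int, (i : nat)%:Z - (j : nat)%:Z = p%:Z * m.
    exists ((N i)%:Z - (N j)%:Z - (c i - (plength (mu i))%:Z)
            + (c j - (plength (mu j))%:Z)).
    by move: Hi Hj; rewrite !PoszD !PoszM; lia.
  have m0 : m = 0 by nia.
  by move: mE; rewrite m0; lia.
exists e, N; split=> //; first by move=> i; rewrite eN VE.
have posI := position_inj p_gt0 (N := N) e_lt e_inj mu_beta_inj.
pose n k := beta_num l k.
have pos_ex (x : {i : 'I_p & 'I_(N i)} + {i : 'I_p & 'I_(plength (mu i))}) :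
    exists k : 'I_r, n k = position e mu_beta x.
  suff /mayaP[|[k kE]] : maya l ((position e mu_beta x)%:Z - r%:Z).
  - by move=> ?; exfalso; lia.
  - by exists k; rewrite /n; lia.
  case: x => [[i t]|[i k]] /=.
    have -> : (e i + p * t)%N%:Z - r%:Z =
        p%:Z * (c i - (plength (mu i))%:Z - (N i)%:Z + t%:Z) + i%:Z.
      by have := VE i; rewrite -eN /U !PoszD !PoszM; lia.
    by apply/maya_quotient; left; have := ltn_ord t; lia.
  have -> : (e i + p * (N i + mu_beta (existT _ i k)))%N%:Z - r%:Z =
      p%:Z * (c i - (plength (mu i))%:Z + (beta_num (mu i) k)%:Z) + i%:Z.
    by have := VE i; rewrite -eN /U mulnDr !PoszD !PoszM /mu_beta /=; lia.
  by apply/maya_quotient; right; exists k.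
have pos_all (k : 'I_r) :
  exists x : {i : 'I_p & 'I_(N i)} + {i : 'I_p & 'I_(plength (mu i))},
    position e mu_beta x = n k.
  pose z := (n k)%:Z - r%:Z.
  have mz : maya l z by apply/mayaP; right; exists k.
  have p0 : p%:Z != 0 by lia.
  have ip : (absz (z %% p)%Z < p)%N.
    by have := modz_ge0 z p0; have := ltz_mod z p0; lia.
  pose i := Ordinal ip; pose m := (z %/ p)%Z.
  have zE : z = p%:Z * m + i%:Z.
    by rewrite /= gez0_abs ?modz_ge0 // mulrC -divz_eq.
  have nz : (n k)%:Z = z + r%:Z by rewrite /z subrK.
  move: mz; rewrite zE => /maya_quotient[mi|[k' mk]].
    (* Beta numbers are non-negative, so m lies at most [N i] places below the bottom of the
       class. *)
    have [t tE] : exists t : nat, m = c i - (plength (mu i))%:Z - (N i)%:Z + t%:Z.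
      exists (absz (m - (c i - (plength (mu i))%:Z - (N i)%:Z))%R).
      rewrite gez0_abs; first by lia.
      have := VE i; rewrite -eN /U !PoszD !PoszM.
      have := e_lt i; have : 0 <= z + r%:Z by rewrite -nz.
      by rewrite zE; nia.
    have tN : (t < N i)%N by lia.
    exists (inl (Tagged (fun i => 'I_(N i)) (Ordinal tN))) => /=.
    apply/eqP; rewrite -eqz_nat; apply/eqP.
    have := VE i; rewrite -eN /U !PoszD !PoszM.
    by rewrite nz zE tE; lia.
  exists (inr (Tagged (fun i => 'I_(plength (mu i))) k')) => /=.
  apply/eqP; rewrite -eqz_nat; apply/eqP.
  have := VE i; rewrite -eN /U mulnDr !PoszD !PoszM.
  by rewrite nz zE mk (_ : mu_beta _ = beta_num (mu i) k') //; lia.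
have [g gE] := boolp.choice pos_ex; have [f fE] := boolp.choice pos_all.
exists f => [|k]; last by rewrite fE.
exists g => [k|x]; last by apply: posI; rewrite fE gE.
by apply: (@beta_num_inj l); rewrite -/(n _) gE fE.
Qed.

End Quotient.

(** * The limit polynomial *)

(** After sorting, the entry at index k is at least k. *)
Lemma sum_injective_ge (r : nat) (b : 'I_r -> nat) : injective b ->
  ('C(r, 2) <= \sum_k b k)%N.
Proof.
move=> bI; pose s := sort leq [seq b k | k <- enum 'I_r].
have sz : size s = r by rewrite size_sort size_map size_enum_ord.
have s_lt : sorted ltn s.
  rewrite ltn_sorted_uniq_leq sort_uniq map_inj_uniq // enum_uniq /=.
  exact: (sort_sorted leq_total).
have s_ge k : (k < size s)%N -> (k <= nth 0%N s k)%N.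
  elim: k => // k IH ks; apply: leq_ltn_trans (IH (ltnW ks)) _.
  apply: (sorted_ltn_nth ltn_trans) => //; exact: ltnW.
have -> : (\sum_k b k = \sum_(k < r) nth 0%N s k)%N.
  rewrite -[in RHS]sz -(big_mkord predT (nth 0%N s)) -(big_nth 0%N predT id).
  rewrite (perm_big _ (permEl (perm_sort leq _))) /= big_map.
  by rewrite big_enum.
by rewrite -ord_sum_bin; apply: leq_sum => k _; apply: s_ge; rewrite sz.
Qed.

Section TaggedSums.
Variables (p : nat) (ell : 'I_p -> nat).
Local Notation exc := {i : 'I_p & 'I_(ell i)}.
Local Notation Tag i k := (Tagged (fun i => 'I_(ell i)) (k : 'I_(ell i))).

Lemma big_tag (V : Type) (idx : V) (op : Monoid.com_law idx) (P : pred exc)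
    (f : exc -> V) i :
  \big[op/idx]_(y | P y && (tag y == i)) f y =
  \big[op/idx]_(k : 'I_(ell i) | P (Tag i k)) f (Tag i k).
Proof.
rewrite -[RHS](big_pred1_eq op i (fun i => \big[op/idx]_(k : 'I_(ell i) |
   P (Tag i k)) f (Tag i k))).
rewrite (sig_big_dep _ (fun i k => P (Tag i k)) (fun i k => f (Tag i k))) /=.
by apply: eq_big => -[i' k] //=; rewrite andbC.
Qed.

(** [sum_vdm_weights] within one class: the total weight is the excess of the heights over the
    minimal configuration 0, 1, 2, ... *)
Lemma sum_class_weight (F : numFieldType) (beta : exc -> nat) i :
  tag_injective beta ->
  \sum_(y | tag y == i) class_weight F beta y =
  (\sum_k beta (Tag i k))%:R - 'C(ell i, 2)%:R.
Proof.
move=> bI; rewrite (big_tag _ predT) natr_sum -sum_vdm_weights; last first.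
  move=> k k' /eqP; rewrite eqr_nat => /eqP/bI => /(_ erefl)/eqP.
  by rewrite eq_Tagged /= => /eqP.
apply: eq_bigr => k _; rewrite /class_weight; congr (_ * _).
rewrite (big_tag _ (fun y => y != Tag i k)) /=.
by apply: eq_bigl => k'; rewrite eq_Tagged.
Qed.

End TaggedSums.

(** * Polynomials with prescribed roots and their coefficient recursion *)

Section LimitPolynomial.
Variables (F : fieldType) (p : nat) (al : 'I_p -> F).

Definition root_poly (m : 'I_p -> nat) : {poly F} :=
  \prod_i ('X - (al i)%:P) ^+ m i.

(** The logarithmic derivative with x / (x - alpha_i) = 1 + alpha_i / (x - alpha_i), cleared of
    denominators; for [m i = 0] the truncated predecessor has coefficient 0. *)
Lemma root_poly_euler (m : 'I_p -> nat) : 'X * (root_poly m)^`() =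
  (\sum_i m i)%:R * root_poly m
  + \sum_i ((m i)%:R * al i)%:P * root_poly (upd m i (m i).-1).
Proof.
rewrite /root_poly deriv_prod mulr_sumr natr_sum mulr_suml -big_split /=.
apply: eq_bigr => i _.
rewrite (prod_upd (fun x (v : nat) => ('X - (al x)%:P) ^+ v)).
rewrite [X in _ * X + _](bigD1 i) //= deriv_exp derivXsubC mul1r.
rewrite polyCM polyC_natr -[_ *+ m i]mulr_natl.
case: (m i) => [|k] /=; first by rewrite !(mul0r, mulr0) addr0.
by rewrite exprS; ring.
Qed.

Lemma root_poly_coef_eq (m : 'I_p -> nat) e :
  ((\sum_i m i)%:R - e%:R) * (root_poly m)`_e =
  - \sum_i (m i)%:R * al i * (root_poly (upd m i (m i).-1))`_e.
Proof.
have := congr1 (fun g : {poly F} => g`_e) (root_poly_euler m).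
rewrite /= coefXM coefD coef_sum -polyC_natr coefCM.
under [X in _ = _ + X]eq_bigr do rewrite coefCM.
move=> E; apply: oppr_inj; rewrite opprK.
apply: (addrI ((\sum_i m i)%:R * (root_poly m)`_e)); rewrite -E.
suff -> : (if e == 0%N then 0 else (root_poly m)^`()`_e.-1) =
    e%:R * (root_poly m)`_e by ring.
by case: e {E} => [|e]; rewrite ?mul0r //= coef_deriv mulr_natl.
Qed.

Lemma size_root_poly (m : 'I_p -> nat) :
  size (root_poly m) = (\sum_i m i).+1.
Proof.
suff: root_poly m \is monic /\ size (root_poly m) = (\sum_i m i).+1 by case.
rewrite /root_poly; elim/big_ind2: _ => [|g a g' a' [gm sg] [gm' sg']|i _].
- by rewrite monic1 size_poly1.
- by rewrite monicMr // size_Mmonic ?monic_neq0 // sg sg' addnS.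
- by rewrite monic_exp ?monicXsubC // size_exp_XsubC.
Qed.

Lemma root_poly_monic (m : 'I_p -> nat) : root_poly m \is monic.
Proof. by apply: monic_prod => i _; rewrite monic_exp ?monicXsubC. Qed.

Lemma horner_root_poly (m : 'I_p -> nat) x :
  (root_poly m).[x] = \prod_i (x - al i) ^+ m i.
Proof.
by rewrite horner_prod; apply: eq_bigr => i _; rewrite horner_exp hornerXsubC.
Qed.

End LimitPolynomial.

(* Uniformity in [v] covers the classes with equal slopes a_i = a_j, where [v]
   need not tend to infinity: non-divisibility by p keeps the denominators at
   distance at least 1 from 0. *)
Lemma cross_weight_bound (R : realFieldType) (p : nat) (ell : 'I_p -> nat)
    (beta : {i : 'I_p & 'I_(ell i)} -> nat) y i :
  exists C : R, forall v : int, ~~ (p %| v)%Z ->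
    `|cross_weight R v beta y i - v%:~R| <= C.
Proof.
suff bound (s : seq {i : 'I_p & 'I_(ell i)}) : exists C : R, forall v : int,
    ~~ (p %| v)%Z -> `|(v%:~R + (p * beta y)%:R) * \prod_(y' <- s | tag y' == i)
      (1 - p%:R / (v%:~R + (p * beta y)%:R - (p * beta y')%:R)) - v%:~R| <= C.
  by have [C HC] := bound (index_enum _); exists C.
elim: s => [|x s [C IH]].
  exists (p * beta y)%:R => v _.
  by rewrite big_nil mulr1 addrAC subrr add0r ger0_norm.
case tx: (tag x == i); last first.
  by exists C => v /IH; rewrite big_cons tx.
pose bx : R := (p * beta x)%:R.
pose c : R := (p * beta y)%:R.
(* With z and P as below, the new factor changes z P - v by -p (1 + (z P - v - c + bx) / (z - bx)),
   whose denominator has absolute value at least 1. *)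
exists (C + p%:R * (1 + (C + c + bx))) => v pv; rewrite big_cons tx.
have := IH v pv.
set z := v%:~R + _; set P := \prod_(_ <- _ | _) _ => CP.
have dist : 1 <= `|z - bx|.
  rewrite (_ : z - bx = (v + (p * beta y)%:Z - (p * beta x)%:Z)%:~R); last first.
    by rewrite rmorphB rmorphD /= /z /bx -!pmulrn.
  rewrite -intr_norm ler1z -gtz0_ge1 normr_gt0.
  apply: contraNneq pv => v0; apply/dvdzP.
  by exists ((beta x)%:Z - (beta y)%:Z); move: v0; rewrite !PoszM mulrBl; lia.
have d0 : z - bx != 0 by rewrite -normr_gt0 (lt_le_trans _ dist).
have -> : z * ((1 - p%:R / (z - bx)) * P) - v%:~R =
    (z * P - v%:~R) - p%:R * (1 + (z * P - v%:~R - c + bx) / (z - bx)).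
  have -> : v%:~R = z - c by rewrite /z addrK.
  by clearbody z P bx c; field.
apply: le_trans (ler_normB _ _) _; apply: lerD => //.
rewrite normrM ger0_norm // ler_wpM2l //.
apply: le_trans (ler_normD _ _) _; rewrite normr1 lerD2l normrM normfV.
rewrite ler_pdivrMr ?(lt_le_trans _ dist) //.
have nonneg : 0 <= C + c + bx.
  by rewrite !addr_ge0 ?ler0n // (le_trans _ CP).
apply: le_trans (ler_peMr nonneg dist).
apply: le_trans (ler_normD _ _) _; apply: lerD; last by rewrite ger0_norm.
apply: le_trans (ler_normB _ _) _; apply: lerD => //.
by rewrite ger0_norm.
Qed.

(** * Asymptotics *)

(** By compactness it suffices to compare both functions for (x, k) near each (x0, infinity), where
    limits of sums and products apply. *)
Lemma poly_cvg_compact (K : numFieldType) (n : nat) (G : nat -> nat -> K)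
    (L : nat -> K) :
  (forall s, (s < n)%N -> G k s @[k --> \oo] --> (L s : K^o)) ->
  {family compact,
    (fun (k : nat) (x : K^o) => \sum_(s < n) G k s * x ^+ s : K^o) @ \oo -->
    (fun x : K^o => \sum_(s < n) L s * x ^+ s : K^o)}.
Proof.
move=> GL; apply/fam_cvgP => A cA P /uniform_nbhs [E [entE EP]].
pose f (x : K^o) : K^o := \sum_(s < n) L s * x ^+ s.
pose fk (k : nat) (x : K^o) : K^o := \sum_(s < n) G k s * x ^+ s.
have cov : \forall k \near \oo, A `<=` [set x | E (f x, fk k x)].
  move/compact_near_coveringP: cA; apply => x Ax.
  have xs s : (z.1 ^+ s : K^o) @[z --> (nbhs x, \oo)] --> (x ^+ s : K^o).
    elim: s => [|s IHs].
      by rewrite [X in X @ _ --> _](_ : _ = cst 1) //; exact: cvg_cst.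
    rewrite [X in X @ _ --> _](_ : _ = (fun z : K^o * nat => z.1 * z.1 ^+ s : K)).
      rewrite exprS; apply: cvgM => //; exact: cvg_fst.
    by apply/funext => z; rewrite exprS.
  have fx : f z.1 @[z --> (nbhs x, \oo)] --> f x.
    apply: cvg_big => [|s _]; first exact: add_continuous.
    by apply: cvgM; [exact: cvg_cst|exact: xs].
  have fkx : fk z.2 z.1 @[z --> (nbhs x, \oo)] --> f x.
    apply: cvg_big => [|s _]; first exact: add_continuous.
    apply: cvgM; last exact: xs.
    apply: (@cvg_comp _ _ _ snd (fun k => G k s) _ \oo); first exact: cvg_snd.
    exact: GL.
  move/cvg_entourageP: fx => /(_ _ (entourage_inv (entourage_split_ent entE))) fx.
  move/cvg_entourageP: fkx => /(_ _ (entourage_split_ent entE)) fkx.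
  near=> z.
  (* Both values are compared with [f] at the centre of the neighbourhood. *)
  apply: (@entourage_split _ (f x)) => //=.
    by near: z; exact: fx.
  by near: z; exact: fkx.
apply: filterS cov => k Ak; apply: EP => y Ay; exact: Ak.
Unshelve. all: by end_near. Qed.

Section Limits.
Variables (R : realType) (p : nat).
Hypothesis p_gt0 : (0 < p)%N.
Variables (ell : 'I_p -> nat) (a : 'I_p -> R) (u : nat -> 'I_p -> int).
Hypothesis u_cvg : forall i i', i != i' ->
  (u k i - u k i')%:~R / (p * k)%:R @[k --> \oo] --> a i - a i'.
Hypothesis u_ndvd : forall k i i', i != i' -> ~~ (p %| u k i - u k i')%Z.

Local Notation exc := {i : 'I_p & 'I_(ell i)}.

Lemma cst_div_cvg0 (C : R) : C / (p * k)%:R @[k --> \oo] --> 0.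
Proof.
have inv0 : (k%:R^-1 : R) @[k --> \oo] --> 0.
  by rewrite -cvg_shiftS; exact: cvg_harmonic.
rewrite [X in X @ _ --> _](_ : _ = fun k : nat => C / p%:R * k%:R^-1); last first.
  by apply/funext => k; rewrite natrM invfM mulrA.
rewrite -(mulr0 (C / p%:R)); apply: cvgM => //; exact: cvg_cst.
Qed.

(** The deviation from the difference of bottoms is bounded, so it disappears after division by p
    k. *)
Lemma cross_weight_cvg (beta : exc -> nat) y i : i != tag y ->
  cross_weight R (u k (tag y) - u k i) beta y i / (p * k)%:R @[k --> \oo]
  --> a (tag y) - a i.
Proof.
move=> iy; have [C HC] := cross_weight_bound R beta y i.
rewrite -[a (tag y) - a i]addr0.
pose v k := u k (tag y) - u k i.
rewrite [X in X @ _ --> _](_ : _ = fun k : nat => (v k)%:~R / (p * k)%:R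
  + (cross_weight R (v k) beta y i - (v k)%:~R) / (p * k)%:R); last first.
  by apply/funext => k; rewrite -mulrDl [X in _ = X / _]addrC subrK.
apply: cvgD; first by apply: u_cvg; rewrite eq_sym.
apply/norm_cvg0P; apply: squeeze_cvgr (cst_div_cvg0 C); last exact: cvg_cst.
apply: nearW => k; rewrite normr_ge0 /= normrM normfV [X in _ / X]ger0_norm //.
by rewrite ler_wpM2r ?invr_ge0 // HC // u_ndvd // eq_sym.
Qed.

(** The p - 1 cross factors absorb one p k each, and their limits multiply to alpha_i. *)
Lemma exc_weight_cvg (beta : exc -> nat) y :
  exc_weight R (u k) beta y / (p%:R * (p * k)%:R ^+ p.-1) @[k --> \oo]
  --> class_weight R beta y * alpha a (tag y).
Proof.
rewrite [X in X @ _ --> _](_ : _ = fun k : nat => class_weight R beta y *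
    \prod_(i | i != tag y)
      (cross_weight R (u k (tag y) - u k i) beta y i / (p * k)%:R)).
  apply: cvgM; first exact: cvg_cst.
  rewrite /alpha; apply: cvg_big; first exact: mul_continuous.
  by move=> i iy; apply: cross_weight_cvg.
apply/funext => k; rewrite prodf_div (prodr_const (predC1 (tag y))) cardC1 card_ord.
rewrite /exc_weight invfM; set P := \prod_(_ | _) _.
have pR0 : (p%:R : R) != 0 by rewrite pnatr_eq0 -lt0n.
by rewrite -[p%:R * _ * P]mulrA mulrACA divff // mul1r -mulrA.
Qed.

(** Induction on j: in the limit the recursion of [ecoef] becomes that of [root_poly]. Here [m i] is
    the excess of class [i], which each move in that class lowers by one. *)
Lemma ecoef_cvg j (beta : exc -> nat) (m : 'I_p -> nat) e :
  tag_injective beta ->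
  (forall i, \sum_k beta (Tagged (fun i => 'I_(ell i)) (k : 'I_(ell i)))
    = 'C(ell i, 2) + m i)%N ->
  (\sum_i m i = j + e)%N ->
  ecoef R j (u k) beta / ((p * k)%:R ^+ p.-1) ^+ j @[k --> \oo]
  --> (root_poly (alpha a) m)`_e.
Proof.
elim: j beta m => [|j IH] beta m bI bm mE.
  rewrite (_ : _`_e = 1).
    rewrite [X in X @ _ --> _](_ : _ = fun _ : nat => 1); first exact: cvg_cst.
    by apply/funext => k; rewrite /= expr0 divr1.
  have := root_poly_monic (alpha a) m.
  by rewrite monicE lead_coefE size_root_poly /= mE => /eqP.
have j0 : (j.+1%:R : R) != 0 by rewrite pnatr_eq0.
pose Ly (y : exc) := (root_poly (alpha a) (upd m (tag y) (m (tag y)).-1))`_e.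
(* The term of class [i] in the root recursion is spread over its excited elements, whose class
   weights sum to [m i]. *)
have -> : (root_poly (alpha a) m)`_e =
    - (\sum_y class_weight R beta y * alpha a (tag y) * Ly y) / j.+1%:R.
  apply: (mulIf j0); rewrite divfK // mulrC.
  have := root_poly_coef_eq (alpha a) m e; rewrite mE natrD addrK => ->.
  congr (- _); rewrite [RHS](partition_big tag predT) //=.
  apply: eq_bigr => i _.
  rewrite (eq_bigr (fun y => class_weight R beta y * (alpha a i *
    (root_poly (alpha a) (upd m i (m i).-1))`_e))) => [|y /eqP <-]; last first.
    by rewrite -mulrA.
  rewrite -mulr_suml (sum_class_weight R i bI) bm natrD addrC addKr.
  by rewrite mulrA.
rewrite [X in X @ _ --> _](_ : _ = fun k : nat =>
  - (\sum_y exc_weight R (u k) beta y / (p%:R * (p * k)%:R ^+ p.-1) *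
    (ecoef R j (u k) (upd beta y (beta y).-1) / ((p * k)%:R ^+ p.-1) ^+ j))
    / j.+1%:R); last first.
  apply/funext => k /=; rewrite !mulNr; congr (- _); rewrite !mulr_suml.
  apply: eq_bigr => y _; rewrite natrM exprS !invfM; ring.
apply: cvgM; last exact: cvg_cst.
apply: cvgN; apply: cvg_big => [|y _]; first exact: add_continuous.
(* If the class weight is zero the term vanishes for every k; otherwise the moved configuration is
   again injective and the induction hypothesis applies. *)
have [w0|w0] := eqVneq (class_weight R beta y) 0.
  rewrite w0 !mul0r [X in X @ _ --> _](_ : _ = fun _ : nat => 0).
    exact: cvg_cst.
  by apply/funext => k; rewrite /exc_weight w0 mulr0 !mul0r.
apply: cvgM; first exact: exc_weight_cvg.
have [b0 uI] := class_weight_neq0 bI w0.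
pose T i (k : 'I_(ell i)) : exc := Tagged (fun i => 'I_(ell i)) k.
have sum_tag i (g : exc -> nat) :
    (\sum_k g (T i k) = \sum_(y | tag y == i) g y)%N.
  by rewrite (big_tag _ predT).
have sum_y : (\sum_k upd beta y (beta y).-1 (T (tag y) k)).+1 =
    (\sum_k beta (T (tag y) k))%N.
  rewrite !sum_tag (bigD1 y) //= upd_eq [in RHS](bigD1 y) //=.
  rewrite (eq_bigr beta) => [|y' /andP[_ yy']]; last by rewrite upd_neq.
  by rewrite -addSn prednK.
(* The moved heights are still distinct, so the class had positive excess before the move. *)
have m_gt0 : (0 < m (tag y))%N.
  have := sum_injective_ge (b := fun k => upd beta y (beta y).-1 (T (tag y) k)).
  rewrite -ltnS sum_y bm => H.
  suff : ('C(ell (tag y), 2) < 'C(ell (tag y), 2) + m (tag y))%N by lia.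
  apply: H => k k' /uI => /(_ erefl)/eqP.
  by rewrite eq_Tagged /= => /eqP.
apply: IH => // [i|]; last first.
  apply: (@addIn (m (tag y))); rewrite sum_upd mE.
  by rewrite -[X in _ = (_ + X)%N](prednK m_gt0) !addSn addnS.
case: (eqVneq i (tag y)) => [->|iy].
  apply: succn_inj; rewrite upd_eq sum_y bm -addnS prednK //.
rewrite upd_neq // -bm; apply: eq_bigr => k _; rewrite upd_neq //.
by apply: contra_neq iy => <-.
Qed.

End Limits.

(** * Coefficients of the remainder polynomial *)

(** [ecoef] is a rational expression in integers; this transfers the real limits to polynomials over
    [R[i]]. *)
Lemma rmorph_ecoef (F F' : numFieldType) (g : {rmorphism F -> F'}) (p : nat)
    (ell : 'I_p -> nat) j u (beta : {i : 'I_p & 'I_(ell i)} -> nat) :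
  g (ecoef F j u beta) = ecoef F' j u beta.
Proof.
elim: j beta => [|j IH] beta /=; first exact: rmorph1.
rewrite rmorphM rmorphN fmorphV !rmorph_nat rmorph_sum /=; congr (- _ / _).
apply: eq_bigr => y _; rewrite rmorphM IH; congr (_ * _).
rewrite /exc_weight /class_weight !rmorphM !rmorph_nat !rmorph_prod /=.
congr (_ * (_ * _) * _).
  apply: eq_bigr => y' _.
  by rewrite rmorphM fmorphV !rmorphB !rmorph_nat rmorph1.
apply: eq_bigr => i _; rewrite /cross_weight.
rewrite rmorphM rmorphD rmorph_int rmorph_nat rmorph_prod; congr (_ * _).
apply: eq_bigr => y' _.
by rewrite rmorphB rmorph1 rmorphM fmorphV rmorphB rmorphD rmorph_int !rmorph_nat.
Qed.

Lemma wronskianE (F : numFieldType) (p : nat) (l : intpart) :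
  wronskian F p l = wr F p (fun k : 'I_(plength l) => beta_num l k).
Proof.
rewrite /wronskian /wr -det_tr; congr (\det _).
by apply/matrixP => i j; rewrite !mxE.
Qed.

(** The value [e i + p * N i] of [quotient_position], written without reference to the chosen [e]
    and [N]. *)
Definition bottom (p : nat) (l : intpart) (c : 'I_p -> int)
    (mu : 'I_p -> intpart) (i : 'I_p) : int :=
  p%:Z * (c i - (plength (mu i))%:Z) + i%:Z + (plength l)%:Z.

Lemma qwronskian_coef (F : numFieldType) (p : nat) (l : intpart)
    (c : 'I_p -> int) (mu : 'I_p -> intpart) e j : (0 < p)%N ->
  char_quotient l c mu -> psize l = (e + p * j)%N ->
  (qwronskian F p l)`_e = ecoef F j (bottom l c mu) (@mu_beta p mu).
Proof.
move=> p0 lcmu le.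
have nI := @beta_num_inj l.
rewrite /qwronskian coefZ wronskianE.
rewrite (wr_coef F p0 (j := j) (e := e) nI); last first.
  by rewrite sum_beta_num le addnA.
rewrite mulrA -[vandermonde_diff F l]/(vdmn F (fun k : 'I_(plength l) => beta_num l k)).
rewrite mulVf ?vdmn_neq0 // mul1r.
have [e' [N [e_lt e_inj eN [f fB fE]]]] := quotient_position p0 lcmu.
have -> : (fun k : 'I_(plength l) => beta_num l k) =
    position e' (@mu_beta p mu) \o f.
  by apply/funext.
rewrite rcoef_bij // rcoef_position //; last exact: mu_beta_inj.
by congr ecoef; apply/funext => i; rewrite eN.
Qed.

Lemma size_qwronskian (F : numFieldType) (p : nat) (l : intpart) :
  (0 < p)%N -> size (qwronskian F p l) = (psize l).+1.
Proof.
move=> p0; have nI := @beta_num_inj l.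
have V0 := vdmn_neq0 F nI.
rewrite /qwronskian size_scale ?invr_eq0 // wronskianE.
apply/eqP; rewrite eqn_leq; apply/andP; split.
  apply/leq_sizeP => e le; apply: (wr_coef_big F p0).
  by rewrite sum_beta_num; lia.
rewrite ltnNge; apply: contraNN V0 => /leq_sizeP/(_ _ (leqnn _)).
by rewrite (wr_coef_top F p0 (e := psize l)) ?sum_beta_num // => ->; rewrite eqxx.
Qed.

Lemma remainder_coef (F : numFieldType) (p : nat) (l lbar : intpart)
    (c : 'I_p -> int) (mu : 'I_p -> intpart) d (P : {poly F}) s : (0 < p)%N ->
  char_quotient l c mu -> is_remainder p l lbar d P -> (s <= d)%N ->
  P`_s = ecoef F (d - s) (bottom l c mu) (@mu_beta p mu).
Proof.
move=> p0 lcmu [Pm sP qE] sd.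
(* Compares the degree of x^|lbar| P(x^p) with the degree |l| of the normalised Wronskian. *)
have psE : psize l = (psize lbar + p * d)%N.
  apply: succn_inj; rewrite -(size_qwronskian F l p0) qE.
  have Q0 : P \Po 'X^p != 0.
    by rewrite comp_poly_eq0 ?monic_neq0 // size_polyXn ltnS.
  rewrite size_monicM ?monicXn // size_polyXn addSn /=.
  rewrite -(prednK (_ : (0 < size (P \Po 'X^p))%N)) ?size_poly_gt0 //.
  by rewrite size_comp_poly sP size_polyXn addnS /= mulnC.
rewrite -(@qwronskian_coef F p l c mu (psize lbar + p * s) (d - s)) //; last first.
  by rewrite psE -addnA -mulnDr subnKC.
by rewrite qE coefXnM ltnNge leq_addr /= addKn coef_comp_poly_Xn // dvdn_mulr // mulKn.
Qed.

(** * Asymptotics of the class bottoms and passage to complex numbers *)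

Lemma bottomB (p : nat) (l : intpart) c mu (i i' : 'I_p) :
  bottom l c mu i - bottom l c mu i' = p%:Z * (c i - c i')
    + (p%:Z * ((plength (mu i'))%:Z - (plength (mu i))%:Z) + (i%:Z - i'%:Z)).
Proof. by rewrite /bottom; lia. Qed.

(** The difference is congruent to i - i' mod p, and 0 < |i - i'| < p. *)
Lemma bottom_ndvd (p : nat) (l : intpart) c mu (i i' : 'I_p) : i != i' ->
  ~~ (p %| bottom l c mu i - bottom l c mu i')%Z.
Proof.
apply: contraNN => /dvdzP[m mE]; rewrite -val_eqE /=; apply/eqP.
have [m' m'E] : exists m' : int, i%:Z - i'%:Z = p%:Z * m'.
  exists (m - (c i - c i') - ((plength (mu i'))%:Z - (plength (mu i))%:Z)).
  by move: mE; rewrite bottomB; lia.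
have := ltn_ord i; have := ltn_ord i' => ip' ip.
have m0 : m' = 0 by nia.
by move: m'E; rewrite m0; lia.
Qed.

Lemma littleo_ratio_cvg (R : realType) (f : nat -> R) (a : R) :
  f = (fun k : nat => a * k%:R : R) +o_\oo (fun k : nat => k%:R : R) ->
  f k / k%:R @[k --> \oo] --> a.
Proof.
move/eqaddoP => fo; apply/cvgrPdist_le => eps eps0.
near=> k; have k0 : (0 < k)%N by near: k; exact: nbhs_infty_gt.
have kR : 0 < (k%:R : R) by rewrite ltr0n.
have : `|(f - (fun k : nat => a * k%:R)) k| <= eps * `|k%:R : R|.
  by near: k; exact: fo.
rewrite [`|k%:R|]ger0_norm // -ler_pdivrMr // => H; apply: le_trans H.
have -> : a - f k / k%:R = - ((f - (fun k : nat => a * k%:R)) k / k%:R).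
  by rewrite [(f - _) k]/(f k - a * k%:R) mulrBl mulfK ?gt_eqF // opprB.
by rewrite normrN normrM normfV [`|k%:R|]ger0_norm.
Unshelve. all: by end_near. Qed.

Lemma bottom_cvg (R : realType) (p : nat) (mu : 'I_p -> intpart)
    (c : nat -> 'I_p -> int) (a : 'I_p -> R) (l : nat -> intpart) (i i' : 'I_p) :
  (0 < p)%N ->
  (forall i : 'I_p, (fun k : nat => (c k i)%:~R : R)
     = (fun k : nat => a i * k%:R : R) +o_\oo (fun k : nat => k%:R : R)) ->
  (bottom (l k) (c k) mu i - bottom (l k) (c k) mu i')%:~R / (p * k)%:R
    @[k --> \oo] --> a i - a i'.
Proof.
move=> p0 ca; have pR0 : (p%:R : R) != 0 by rewrite pnatr_eq0 -lt0n.
pose C : R := (p%:Z * ((plength (mu i'))%:Z - (plength (mu i))%:Z)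
  + (i%:Z - i'%:Z))%:~R.
rewrite -[a i - a i']addr0 [X in X @ _ --> _](_ : _ = fun k : nat =>
    ((c k i)%:~R / k%:R - (c k i')%:~R / k%:R) + C / (p * k)%:R); last first.
  apply/funext => k; rewrite bottomB intrD mulrDl; congr (_ + _).
  rewrite intrM -pmulrn natrM invfM mulrACA divff // mul1r -mulrBl.
  by rewrite rmorphB.
apply: cvgD; last exact: cst_div_cvg0.
by apply: cvgB; exact: littleo_ratio_cvg.
Qed.

Lemma cvg_real_complex (R : realType) (f : nat -> R) (l : R) :
  f k @[k --> \oo] --> l ->
  ((f k)%:C : R[i]^o) @[k --> \oo] --> (l%:C : R[i]^o).
Proof.
move=> fl; apply/cvgrPdist_lt => eps; rewrite ltcE /= => /andP[/eqP eps_re eps0].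
(* In the order of [R[i]] a positive element is real. *)
have -> : eps = (complex.Re eps)%:C.
  by case: eps eps_re eps0 => x y /= ->.
move/cvgrPdist_lt : fl => /(_ _ eps0); apply: filterS => k.
rewrite -rmorphB normc_def /= expr0n /= addr0 sqrtr_sqr.
by rewrite ltcR.
Qed.

Theorem theorem3p1 (R : realType) (p : nat) (mu : 'I_p -> intpart)
    (c : nat -> 'I_p -> int) (a : 'I_p -> R)
    (lam lbar : nat -> intpart) (Rlam : nat -> {poly R[i]}) :
  (0 < p)%N ->
  (forall k : nat, \sum_(i < p) c k i = 0) ->
  (forall i : 'I_p,
     (fun k : nat => (c k i)%:~R : R)
       = (fun k : nat => a i * k%:R : R) +o_\oo (fun k : nat => k%:R : R)) ->
  (forall k : nat, char_quotient (lam k) (c k) mu) ->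
  (forall k : nat, is_core p (lam k) (lbar k)) ->
  (forall k : nat, is_remainder p (lam k) (lbar k) (mu_size mu) (Rlam k)) ->
  {family compact,
    (fun (k : nat) (x : R[i]^o) =>
       (Rlam k).[(p * k)%:R ^+ p.-1 * x] / (p * k)%:R ^+ (p.-1 * mu_size mu))
      @ \oo -->
    (fun x : R[i]^o =>
       \prod_(i < p) (x - (alpha a i)%:C) ^+ psize (mu i) : R[i]^o)}.
Proof.
move=> p0 _ ca lcmu _ rem.
pose d := mu_size mu; pose D k : R[i] := (p * k)%:R ^+ p.-1.
pose m i := psize (mu i); pose P := root_poly (alpha a) m.
pose G k s := (Rlam k)`_s * D k ^+ s / D k ^+ d.
have -> : (fun (k : nat) (x : R[i]^o) =>
      (Rlam k).[(p * k)%:R ^+ p.-1 * x] / (p * k)%:R ^+ (p.-1 * mu_size mu)) =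
    (fun k (x : R[i]^o) => \sum_(s < d.+1) G k s * x ^+ s).
  apply/funext => k; apply/funext => x.
  have [_ sR _] := rem k.
  rewrite (@horner_coef_wide _ d.+1) ?sR // exprM mulr_suml.
  apply: eq_bigr => s _; rewrite /G exprMn /D -!mulrA.
  by congr (_ * (_ * _)); rewrite mulrC.
have -> : (fun x : R[i]^o =>
      \prod_(i < p) (x - (alpha a i)%:C) ^+ psize (mu i) : R[i]^o) =
    (fun x : R[i]^o => \sum_(s < d.+1) (P`_s)%:C * x ^+ s : R[i]^o).
  apply/funext => x; rewrite -(horner_root_poly (fun i => (alpha a i)%:C)).
  rewrite (@horner_coef_wide _ d.+1) ?size_root_poly //.
  apply: eq_bigr => s _; congr (_ * _).
  rewrite -(coef_map (real_complex R)) /P /root_poly rmorph_prod /=.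
  congr ((_ : {poly _})`_s); apply: eq_bigr => i _.
  by rewrite rmorphXn rmorphB /= map_polyX map_polyC.
apply: (@poly_cvg_compact R[i] d.+1 G (fun s => (P`_s)%:C)) => s; rewrite ltnS => sd.
(* D^s / D^d = 1 / D^(d - s) is the normalisation of [ecoef] at index d - s; the limit is first
   taken over the reals. *)
have lim : ecoef R (d - s) (bottom (lam k) (c k) mu) (@mu_beta p mu)
    / ((p * k)%:R ^+ p.-1) ^+ (d - s) @[k --> \oo] --> P`_s.
  apply: ecoef_cvg => //.
  - by move=> i i' _; apply: bottom_cvg.
  - by move=> k i i' ii'; apply: bottom_ndvd.
  - exact: mu_beta_inj.
  - by move=> i; rewrite -sum_beta_num.
  - by rewrite subnK.
apply: cvg_trans (cvg_real_complex lim); apply: near_eq_cvg.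
(* At k = 0 the scaling factor may be zero, so the two sequences are only eventually equal. *)
near=> k; have k0 : (0 < k)%N by near: k; exact: nbhs_infty_gt.
have D0 : D k != 0 by rewrite expf_neq0 // pnatr_eq0 muln_eq0; lia.
rewrite /G (remainder_coef p0 (lcmu k) (rem k) sd).
rewrite rmorphM fmorphV !rmorphXn rmorph_nat rmorph_ecoef -mulrA; congr (_ * _).
by rewrite -[in RHS](subnK sd) exprD invfM mulrCA divff ?mulr1 // expf_neq0.
Unshelve. all: by end_near. Qed.
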